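(* For any integer $t\geq 0$, there exist a graph $G=(V,E)$ and an edge $e\in E$ such that $\operatorname{ppt}(G_e)\geq \operatorname{ppt}(G)+t$, where $G_e$ is the graph obtained from $G$ by subdividing the edge $e$.
   Context: All graphs are finite and simple. For an edge $e=uv$ of $G$, the graph $G_e$ obtained by subdividing $e$ has vertex set $V(G)\cup\{w\}$ with $w$ a new vertex, and edge set $(E(G)\setminus\{uv\})\cup\{uw,wv\}$. For a graph $G$ and $S\subseteq V(G)$, let $N(v)$ be the set of neighbors of $v$ and $N[S]=S\cup\bigcup_{s\in S}N(s)$. Define $S^{[0]}=S$, $S^{[1]}=N[S]$, and for $i\geq 1$, $S^{[i+1]}=S^{[i]}\cup\{w\in V(G) : \exists\, v\in S^{[i]},\ N(v)\setminus S^{[i]}=\{w\}\}$. The set $S$ is a power dominating set of $G$ if $S^{[\ell]}=V(G)$ for some $\ell$; a minimum power dominating set is one of minimum cardinality. For a power dominating set $S$, $\operatorname{ppt}(G,S)$ is the smallest $\ell\ge 0$ with $S^{[\ell]}=V(G)$. The power propagation time of $G$ is $\operatorname{ppt}(G)=\min\{\operatorname{ppt}(G,S) : S \text{ is a minimum power dominating set of } G\}$. *)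

(* Defs.v *)
From mathcomp Require Import all_boot.
From mathcomp Require Import boolp.

Set Implicit Arguments.
Unset Strict Implicit.
Unset Printing Implicit Defensive.

Record sgraph := SGraph {
  vertex :> finType;
  adj : rel vertex;
  adj_sym : symmetric adj;
  adj_irr : irreflexive adj }.

Section Subdivision.
Variables (G : sgraph) (u v : G).

(* The new vertex is [None]; the definition is only meaningful when uv is an
   edge of G. *)
Definition subdiv_adj : rel (option G) := fun a b =>
  match a, b with
  | Some x, Some y => adj x y && ([set x; y] != [set u; v])
  | Some x, None | None, Some x => x \in [set u; v]
  | None, None => false
  end.

Lemma subdiv_adj_sym : symmetric subdiv_adj.
Proof. by move=> [x|] [y|] //=; rewrite adj_sym setUC. Qed.

Lemma subdiv_adj_irr : irreflexive subdiv_adj.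
Proof. by case=> [x|] //=; rewrite adj_irr. Qed.

Definition subdivide : sgraph := SGraph subdiv_adj_sym subdiv_adj_irr.
End Subdivision.

Section PowerDomination.
Variable G : sgraph.
Implicit Types S : {set G}.

Definition nbr (x : G) : {set G} := [set y | adj x y].

Definition closed_nbr S : {set G} := S :|: \bigcup_(s in S) nbr s.

Definition force_step S : {set G} :=
  S :|: [set w | [exists x in S, nbr x :\: S == [set w]]].

(* [observed S l] is S^[l]: one domination step, then forcing steps. *)
Definition observed S (l : nat) : {set G} :=
  if l is k.+1 then iter k force_step (closed_nbr S) else S.

Definition power_dominating S : Prop := exists l, observed S l == [set: G].

Definition min_power_dominating S : Prop :=
  power_dominating S /\ forall S', power_dominating S' -> #|S| <= #|S'|.

Definition ppt_set S (pdS : power_dominating S) : nat := ex_minn pdS.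

(* n is ppt(G, S) for some minimum power dominating set S *)
Definition attained_ppt (n : nat) : Prop :=
  exists (S : {set G}) (mS : min_power_dominating S), n = ppt_set (proj1 mS).

Lemma power_dominatingT : power_dominating [set: G].
Proof. by exists 0. Qed.

Lemma exists_attained_ppt : exists n, `[< attained_ppt n >].
Proof.
have pT : `[< power_dominating [set: G] >] by apply/asboolP/power_dominatingT.
have [S /asboolP pS minS] :=
  arg_minnP (P := fun S => `[< power_dominating S >]) (fun S => #|S|) pT.
have mS : min_power_dominating S.
  by split=> // S' pS'; apply: minS; apply/asboolP.
by exists (ppt_set (proj1 mS)); apply/asboolP; exists S, mS.
Qed.

Definition ppt : nat := ex_minn exists_attained_ppt.
End PowerDomination.

(* Main.v *)
Require Import Defs.
From mathcomp Require Import all_boot.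
From mathcomp Require Import boolp zify.

(** Take a long path, join its far end to a hub, and join both its near end and
    the hub to two adjacent vertices, the tips; three pendant leaves at the hub
    make the hub the only power dominating set of size one.

    The hub dominates both tips and the far end of the path.  Since the tips
    see each other, the near end of the path is the only unobserved neighbour
    of each tip, so the path is swept from both ends at once, in about half its
    length.  Subdividing the edge between the tips gives each of them a second
    unobserved neighbour, the new vertex.  Both tips are then blocked until the
    path has been swept all the way from its far end, and the new vertex itself
    comes last.  With a path of [2t + 1] vertices the propagation times are
    [t + 1] at most and [2t + 2] at least.

    Both estimates come from guessing the time [r x] at which each vertex is
    observed.  The guess is an upper bound if every vertex has a neighbour ready
    to force it by its time ([observed_of_rank]), and a lower bound if every
    neighbour of a vertex stays blocked, or unobserved, until then
    ([rank_of_observed]). *)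

Set Implicit Arguments.
Unset Strict Implicit.
Unset Printing Implicit Defensive.

(** * Propagation times in general graphs *)

Section Propagation.
Variable G : sgraph.
Implicit Types (S : {set G}) (c x y z : G) (r : G -> nat).

Lemma observedS S k : observed S k.+2 = force_step (observed S k.+1).
Proof. by []. Qed.

Lemma observed1E c : observed [set c] 1 = c |: nbr c.
Proof. by rewrite /= /closed_nbr big_set1. Qed.

Lemma ppt_le S n : min_power_dominating S -> observed S n = [set: G] ->
  ppt G <= n.
Proof.
move=> mS Sn; apply: (@leq_trans (ppt_set (proj1 mS))).
  rewrite /ppt; case: ex_minnP => k _; apply.
  by apply/asboolP; exists S, mS.
by rewrite /ppt_set; case: ex_minnP => k _; apply; rewrite Sn.
Qed.

Lemma ppt_ge n :
  (forall S l, min_power_dominating S -> observed S l = [set: G] -> n <= l) ->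
  n <= ppt G.
Proof.
move=> n_le; rewrite /ppt; case: ex_minnP => k /asboolP[S [mS ->]] _.
by rewrite /ppt_set; case: ex_minnP => l /eqP Sl _; apply: (n_le S).
Qed.

Lemma power_dominating_neq0 S c : power_dominating S -> 0 < #|S|.
Proof.
case=> l; rewrite card_gt0; apply: contraTneq => ->.
suff -> : observed set0 l = set0 :> {set G}.
  by apply/eqP => /setP/(_ c); rewrite !inE.
elim: l => [//|[_|k IHk]]; first by rewrite /= /closed_nbr set0U big_set0.
rewrite observedS IHk; apply/setP=> x; rewrite !inE /=.
by apply/existsP => -[y]; rewrite inE.
Qed.

(** The vertex [y] in the hypothesis is the one that forces [x]: by time
    [(r x).-1] it is observed, and so are its other neighbours. *)
Lemma observed_of_rank c r :
    (forall x, r x = 0 -> x = c) ->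
    (forall x, r x = 1 -> adj c x) ->
    (forall x, 1 < r x -> exists y, [/\ adj y x, r y < r x &
       forall z, adj y z -> z != x -> r z < r x]) ->
  forall l x, r x <= l -> x \in observed [set c] l.
Proof.
move=> r0 r1 r2; elim=> [|[_|k IHk]] x.
- by rewrite leqn0 => /eqP/r0 ->; rewrite inE.
- rewrite observed1E !inE leq_eqVlt ltnS leqn0.
  by case/orP=> /eqP; [move/r1=> -> | move/r0=> ->]; rewrite ?eqxx ?orbT.
rewrite observedS leq_eqVlt ltnS => /orP[/eqP rx|/IHk xk]; last by rewrite inE xk.
have [|y [yx ry yz]] := r2 x; first by rewrite rx.
rewrite inE; case xk: (x \in _) => //=; rewrite inE; apply/existsP; exists y.
rewrite IHk /=; last by rewrite -ltnS -rx.
apply/eqP/setP=> z; rewrite !inE; case: eqVneq => [->|zx]; first by rewrite xk.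
by apply/andP => -[/negP z_k yzE]; apply/z_k/IHk; rewrite -ltnS -rx yz.
Qed.

(** If [y] forces [x] at some step, then [y] and all its neighbours but [x] are
    observed before; the vertex [z] in the hypothesis prevents that step from
    coming before time [r x]. *)
Lemma rank_of_observed c r :
    r c = 0 ->
    (forall x, adj c x -> r x <= 1) ->
    (forall x y, adj y x -> 1 < r x ->
       exists z, [/\ z != x, (z == y) || adj y z & r x <= (r z).+1]) ->
  forall l x, x \in observed [set c] l -> r x <= l.
Proof.
move=> rc r1 r2; elim=> [|[_|k IHk]] x.
- by rewrite inE => /eqP->; rewrite rc.
- by rewrite observed1E !inE => /orP[/eqP->|/r1 //]; rewrite rc.
rewrite observedS inE => /orP[/IHk/leqW //|].
rewrite inE => /existsP[y /andP[yk /eqP Dx]].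
have [rx|rx] := leqP (r x) 1; first by apply: leq_trans rx _.
have /setDP[] : x \in nbr y :\: observed [set c] k.+1 by rewrite Dx set11.
rewrite inE => yx _; have [z [zx zy]] := r2 x y yx rx.
move/leq_trans; apply; rewrite ltnS; apply: IHk.
case/orP: zy => [/eqP-> //|yz]; apply: contraNT zx => zk.
by rewrite -in_set1 -Dx !inE zk.
Qed.

(** Two unobserved leaves of [c] block each other, since only [c] could force
    either of them. *)
Lemma power_dominating_leaves S c x y :
    x != y -> nbr x = [set c] -> nbr y = [set c] -> power_dominating S ->
  [|| c \in S, x \in S | y \in S].
Proof.
move=> xy Nx Ny [l Sl]; apply: contraTT Sl; rewrite !negb_or => /and3P[cS xS yS].
suff /andP[xl _] : (x \notin observed S l) && (y \notin observed S l).
  by apply: contraNneq xl => ->.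
have adjl w z : nbr z = [set c] -> adj w z -> w = c.
  by move=> Nz; rewrite adj_sym => zw; apply/set1P; rewrite -Nz inE.
elim: l => [|[_|k /andP[xk yk]]]; first by rewrite /= xS yS.
  suff H z : nbr z = [set c] -> z \notin S -> z \notin observed S 1.
    by rewrite !H.
  move=> Nz zS; rewrite /= in_setU negb_or zS /=.
  apply/bigcupP=> -[s sS]; rewrite inE => /(adjl _ _ Nz) sc.
  by rewrite -sc sS in cS.
suff H z z' : nbr z = [set c] -> nbr z' = [set c] -> z != z' ->
    z \notin observed S k.+1 -> z' \notin observed S k.+1 ->
    z \notin observed S k.+2.
  by rewrite (H x y) ?(H y x) // eq_sym.
move=> Nz Nz' zz' zk z'k; rewrite observedS in_setU negb_or zk inE /=.
apply/existsP=> -[w /andP[_ /eqP Dz]].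
have /setDP[] : z \in nbr w :\: observed S k.+1 by rewrite Dz set11.
rewrite inE => /(adjl _ _ Nz) wc _.
case/eqP: zz'; symmetry; apply/set1P; rewrite -Dz !inE z'k wc adj_sym.
by have /setP/(_ c) := Nz'; rewrite !inE eqxx.
Qed.

Lemma set1_min_power_dominating c n :
  observed [set c] n = [set: G] -> min_power_dominating [set c].
Proof.
move=> cn; split; first by exists n; apply/eqP.
by move=> S pS; rewrite cards1; apply: (power_dominating_neq0 c).
Qed.

(** A single vertex other than [c] misses two of the three leaves, which then
    block each other.  Two leaves would not be enough: starting from one of
    them may suffice. *)
Lemma min_power_dominating_hub (c : G) (leaf : 'I_3 -> G) S :
    injective leaf -> (forall i, nbr (leaf i) = [set c]) ->
    power_dominating [set c] -> min_power_dominating S ->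
  S = [set c].
Proof.
move=> leaf_inj Nleaf pc [pS /(_ _ pc)]; rewrite cards1 => S1.
have /eqP/cards1P[s Ss] : #|S| = 1.
  by apply/eqP; rewrite eqn_leq S1 (power_dominating_neq0 c pS).
move: pS; rewrite {S S1}Ss => ps.
congr [set _]; apply/eqP; apply: contraT => sc.
have : #|leaf @^-1: [set s]| <= 1.
  apply/card_le1_eqP=> i j; rewrite !inE => /eqP<- /eqP e.
  exact: leaf_inj.
have := cardsC (leaf @^-1: [set s]); rewrite card_ord => cardE card1.
have /card_gt1P[i [j [si sj ij]]] : 1 < #|~: (leaf @^-1: [set s])| by lia.
have := power_dominating_leaves _ (Nleaf i) (Nleaf j) ps.
rewrite (inj_eq leaf_inj) ij => /(_ isT); move: si sj.
by rewrite !inE => /negPf-> /negPf->; rewrite orbF eq_sym (negPf sc).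
Qed.

End Propagation.

(** * The lasso graph *)

Section Lasso.
Variable m : nat.

Definition lasso_vertex : finType := option ('I_3 + (bool + 'I_m.+1)).

Definition hub : lasso_vertex := None.
Definition leaf (i : 'I_3) : lasso_vertex := Some (inl i).
Definition tip (b : bool) : lasso_vertex := Some (inr (inl b)).
Definition bead (i : 'I_m.+1) : lasso_vertex := Some (inr (inr i)).

(** The beads form the path, numbered from the tips towards the hub.  Listing
    each edge in one direction keeps the case analysis short. *)
Definition lasso_arc (x y : lasso_vertex) : bool :=
  match x, y with
  | None, Some (inl _) | None, Some (inr (inl _)) => true
  | None, Some (inr (inr i)) => i == m :> nat
  | Some (inr (inl b)), Some (inr (inl b')) => b != b'
  | Some (inr (inl _)), Some (inr (inr i)) => i == 0 :> nat
  | Some (inr (inr i)), Some (inr (inr j)) => j == i.+1 :> nat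
  | _, _ => false
  end.

Definition lasso_adj : rel lasso_vertex :=
  fun x y => lasso_arc x y || lasso_arc y x.

Lemma lasso_adj_sym : symmetric lasso_adj.
Proof. by move=> x y; rewrite /lasso_adj orbC. Qed.

Lemma lasso_adj_irr : irreflexive lasso_adj.
Proof.
by case=> [[i|[b|i]]|] //; rewrite /lasso_adj /= ?eqxx //; lia.
Qed.

Definition lasso : sgraph := SGraph lasso_adj_sym lasso_adj_irr.

Definition lasso_rank (x : lasso) : nat :=
  match x with
  | None => 0
  | Some (inr (inr i)) => minn i.+2 (m.+1 - i)
  | _ => 1
  end.

(** Bead [i] is forced by its predecessor (a tip, for the first bead) when it
    lies in the half near the tips, and by its successor otherwise. *)
Lemma lasso_observed l (x : lasso) :
  lasso_rank x <= l -> x \in observed [set (hub : lasso)] l.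
Proof.
apply: observed_of_rank => {x l}.
- by case=> [[i|[b|i]]|] //=; have := ltn_ord i; lia.
- by case=> [[i|[b|i]]|] //=; rewrite /lasso_adj /=; have := ltn_ord i; lia.
case=> [[i|[b|i]]|] //= ri; have im := ltn_ord i.
have [low|high] := leqP i.+2 (m.+1 - i).
- case i0: (i == 0 :> nat).
    exists (tip true); split; rewrite /lasso_adj /= ?i0 //.
    by case=> [[j|[b|j]]|] //=; rewrite -?[bead j == _]/(j == i :> nat); lia.
  have i'm : i.-1 < m.+1 by lia.
  exists (bead (Ordinal i'm)); split; rewrite /lasso_adj /=; try lia.
  by case=> [[j|[b|j]]|] //=; rewrite -?[bead j == _]/(j == i :> nat); lia.
- have i'm : i.+1 < m.+1 by lia.
  exists (bead (Ordinal i'm)); split; rewrite /lasso_adj /=; try lia.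
  by case=> [[j|[b|j]]|] //=; rewrite -?[bead j == _]/(j == i :> nat); lia.
Qed.

Lemma ppt_lasso n : (forall x, lasso_rank x <= n) -> ppt lasso <= n.
Proof.
move=> rn; have hub_n : observed [set (hub : lasso)] n = [set: lasso].
  by apply/setP=> x; rewrite lasso_observed ?inE.
exact: ppt_le (set1_min_power_dominating hub_n) hub_n.
Qed.

(** * The lasso graph with its tips separated *)

Definition cut_lasso : sgraph :=
  subdivide (tip true : lasso) (tip false : lasso).

Definition is_tip (x : lasso) : bool :=
  if x is Some (inr (inl _)) then true else false.

Lemma mem_tips (x : lasso) :
  (x \in [set (tip true : lasso); tip false]) = is_tip x.
Proof. by rewrite !inE; case: x => [[i|[[]|i]]|]. Qed.

Lemma cut_lasso_adjE (x y : cut_lasso) :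
  adj x y = match x, y with
            | Some x, Some y => lasso_adj x y && ~~ (is_tip x && is_tip y)
            | Some x, None | None, Some x => is_tip x
            | None, None => false
            end.
Proof.
case: x y => [x|] [y|] //; try exact: mem_tips.
rewrite /=; case xy: (lasso_adj x y) => //=; congr negb.
apply/eqP/andP=> [tipsE|[]]; first by rewrite -!mem_tips -tipsE set21 set22.
case: x xy => [[i|[b|i]]|] //; case: y => [[j|[b'|j]]|] //.
by case: b; case: b' => // _ _ _; rewrite setUC.
Qed.

Definition cut_lasso_rank (x : cut_lasso) : nat :=
  match x with
  | None => m.+2
  | Some None => 0
  | Some (Some (inr (inr i))) => m.+1 - i
  | Some (Some _) => 1
  end.

(** The sweep runs along the beads from the hub towards the tips.  No tip can
    help it: until the first bead is observed, that bead and the new vertex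
    block both tips. *)
Lemma cut_lasso_observed l (x : cut_lasso) :
  (x \in observed [set (Some hub : cut_lasso)] l) = (cut_lasso_rank x <= l).
Proof.
apply/idP/idP; move: l x.
- apply: rank_of_observed => // [x|x y]; rewrite cut_lasso_adjE.
    case: x => [[[i|[b|i]]|]|] //.
    by rewrite /lasso_adj /=; have := ltn_ord i; lia.
  case: x => [[[i|[b|i]]|]|] //; last first.
    case: y => [[[j|[b|j]]|]|] // _ _.
    by exists (Some (bead ord0)); rewrite cut_lasso_adjE /= subn0.
  have im := ltn_ord i.
  case: y => [[[j|[b|j]]|]|] // yx rx; rewrite /lasso_adj /= in yx rx.
  + by exists None; rewrite cut_lasso_adjE; split=> //=; lia.
  + exists (Some (bead j)); rewrite eqxx; split=> //=; last by lia.
    by apply/eqP=> -[ji]; rewrite ji in yx; lia.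
  + lia.
- apply: observed_of_rank => [x|x|x]; last first.
  + case: x => [[[i|[b|i]]|]|] //; last first.
      exists (Some (tip true)); rewrite cut_lasso_adjE; split=> // z.
      rewrite cut_lasso_adjE; case: z => [[[j|[b|j]]|]|] // _ _ /=; lia.
    have im := ltn_ord i => rx; rewrite /= in rx.
    have i'm : i.+1 < m.+1 by lia.
    exists (Some (bead (Ordinal i'm))); rewrite cut_lasso_adjE /lasso_adj.
    split=> [||z]; rewrite ?cut_lasso_adjE /=; try lia.
    rewrite /lasso_adj; case: z => [[[j|[b|j]]|]|] //=; try lia.
    move=> ji ne; have {ne}: j <> i :> nat.
      by move/val_inj=> ij; rewrite ij eqxx in ne.
    by lia.
  + rewrite cut_lasso_adjE.
    case: x => [[[i|[b|i]]|]|] //=; rewrite /lasso_adj /=.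
    by have := ltn_ord i; lia.
  + by case: x => [[[i|[b|i]]|]|] //=; have := ltn_ord i; lia.
Qed.

End Lasso.

Theorem proposition19 (t : nat) :
  exists (G : sgraph) (u v : G),
    adj u v /\ ppt (subdivide u v) >= ppt G + t.
Proof.
(* With [2t + 1] beads the two sweeps of the lasso meet at time [t + 1]. *)
pose m := t.*2; exists (lasso m), (tip m true), (tip m false); split=> //.
have hub_n : observed [set (Some (hub m) : cut_lasso m)] m.+2 =
    [set: cut_lasso m].
  apply/setP=> x; rewrite cut_lasso_observed inE.
  by case: x => [[[i|[b|i]]|]|] //=; lia.
have pptG : ppt (lasso m) <= t.+1.
  apply: ppt_lasso; case=> [[i|[b|i]]|] //=.
  by have := ltn_ord i; rewrite /m; lia.
apply: leq_trans (leq_add pptG (leqnn t)) _; rewrite addSn addnn -/m.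
apply: leq_trans (leqnSn _) _; apply: ppt_ge => S l mS Sl.
have leaf_inj : injective (fun i => Some (leaf m i) : cut_lasso m) by move=> i j [].
have nbr_leaf i : nbr (Some (leaf m i) : cut_lasso m) = [set Some (hub m)].
  apply/setP=> x; rewrite !inE cut_lasso_adjE.
  by case: x => [[[j|[b|j]]|]|].
have Shub := min_power_dominating_hub leaf_inj nbr_leaf _ mS.
rewrite {}Shub in Sl; last by exists m.+2; rewrite hub_n.
by have := in_setT (None : cut_lasso m); rewrite -Sl cut_lasso_observed.
Qed.
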